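(* Let $P=(p_{ij})$ be an indecomposable pattern with no empty rows or columns, with only one $1$ entry in the last row and only one $1$ entry in the last column, such that $\operatorname{sat}(n,P)=O(1)$ and such that each $1$ entry $p_{ij}$ is the only $1$ entry in row $i$ if and only if it is the only $1$ entry in column $j$. Let the pattern $P'$ be derived from $P$ by adding empty rows and columns in the interior (i.e., strictly between the first and last row and column). Then $\operatorname{sat}(n,P')=O(1)$.
   Context: All matrices are 0-1 matrices; a pattern is a 0-1 matrix. A row or column is empty if it contains no ones. A matrix $M$ contains $P$ if some submatrix of $M$ (obtained by deleting rows and columns) can be turned into $P$ by changing some number (possibly zero) of its ones to zeroes. The weight is the number of $1$ entries. $M$ is $P$-saturated if $M$ does not contain $P$, but changing any $0$ entry of $M$ to a $1$ yields a matrix containing $P$. $\operatorname{sat}(n,P)$ is the minimum weight of an $n\times n$ $P$-saturated matrix; asymptotics are for $n\to\infty$ with the pattern fixed. A matrix is decomposable if it can be written as a block matrix $\begin{pmatrix} A & \mathbf 0\\ \mathbf 0 & B\end{pmatrix}$ or $\begin{pmatrix} \mathbf 0 & A\\ B & \mathbf 0\end{pmatrix}$ with $A$ and $B$ both not all-zero, where $\mathbf 0$ denotes an all-zero matrix of any size; otherwise it is indecomposable. *)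

(* Defs.v *)
From mathcomp Require Import all_boot all_order all_algebra.

Set Implicit Arguments.
Unset Strict Implicit.
Unset Printing Implicit Defensive.

(* Boolean matrices: [true] is a one entry, [false] a zero entry. *)

Definition weight m n (M : 'M[bool]_(m, n)) : nat :=
  #|[set ij : 'I_m * 'I_n | M ij.1 ij.2]|.

Definition increasing m n (f : 'I_m -> 'I_n) : bool :=
  [forall i : 'I_m, forall j : 'I_m, (i < j)%N ==> (f i < f j)%N].

(* The submatrix obtained by deleting rows and columns is [mxsub f g M], with
   f and g the increasing enumerations of the kept rows and columns. *)
Definition contains m n k l (M : 'M[bool]_(m, n)) (P : 'M[bool]_(k, l)) : bool :=
  [exists f : {ffun 'I_k -> 'I_m}, exists g : {ffun 'I_l -> 'I_n},
    [&& increasing f, increasing g &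
        [forall i, forall j, P i j ==> mxsub f g M i j]]].

Definition set_one m n (M : 'M[bool]_(m, n)) (i : 'I_m) (j : 'I_n) :
    'M[bool]_(m, n) :=
  \matrix_(x, y) (((x == i) && (y == j)) || M x y).

Definition saturated m n k l (M : 'M[bool]_(m, n)) (P : 'M[bool]_(k, l)) : bool :=
  ~~ contains M P &&
  [forall i, forall j, ~~ M i j ==> contains (set_one M i j) P].

(* The default value n * n bounds the weight of every n x n matrix, so it does
   not affect the minimum as soon as a saturated matrix exists; one exists
   whenever P has a one entry (see [saturated_exists] and [sat_attained]). *)
Definition sat n k l (P : 'M[bool]_(k, l)) : nat :=
  \big[minn/(n * n)%N]_(M : 'M[bool]_n | saturated M P) weight M.

(* sat(n, P) = O(1) as n tends to infinity. *)
Definition sat_bounded k l (P : 'M[bool]_(k, l)) : Prop :=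
  exists C N : nat, forall n : nat, (N <= n)%N -> (sat n P <= C)%N.

Definition empty_row m n (M : 'M[bool]_(m, n)) (i : 'I_m) : bool :=
  [forall j, ~~ M i j].

Definition empty_col m n (M : 'M[bool]_(m, n)) (j : 'I_n) : bool :=
  [forall i, ~~ M i j].

Definition all_zero m n (M : 'M[bool]_(m, n)) : bool := M == const_mx false.

Definition decomposable m n (M : 'M[bool]_(m, n)) : Prop :=
  exists m1 m2 n1 n2 (e : (m1 + m2 = m)%N * (n1 + n2 = n)%N),
    (exists (A : 'M[bool]_(m1, n1)) (B : 'M[bool]_(m2, n2)),
       [/\ ~~ all_zero A, ~~ all_zero B &
           M = castmx e (block_mx A (const_mx false) (const_mx false) B)]) \/
    (exists (A : 'M[bool]_(m1, n2)) (B : 'M[bool]_(m2, n1)),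
       [/\ ~~ all_zero A, ~~ all_zero B &
           M = castmx e (block_mx (const_mx false) A B (const_mx false))]).

Definition indecomposable m n (M : 'M[bool]_(m, n)) : Prop := ~ decomposable M.

(* f and g send the rows and columns of P to their positions in P'. They fix
   the first and the last index, so every added line is in the interior. *)
Definition adds_interior_empty_lines k l k' l'
    (P : 'M[bool]_(k.+1, l.+1)) (P' : 'M[bool]_(k'.+1, l'.+1)) : Prop :=
  exists (f : 'I_k.+1 -> 'I_k'.+1) (g : 'I_l.+1 -> 'I_l'.+1),
    [/\ [/\ increasing f, f ord0 = ord0 & f ord_max = ord_max],
        [/\ increasing g, g ord0 = ord0 & g ord_max = ord_max],
        P = mxsub f g P',
        forall i, i \notin codom f -> empty_row P' i &
        forall j, j \notin codom g -> empty_col P' j].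

Lemma weight_le m n (M : 'M[bool]_(m, n)) : (weight M <= m * n)%N.
Proof. by rewrite (leq_trans (max_card _)) // card_prod !card_ord. Qed.

Lemma saturated_exists m n k l (P : 'M[bool]_(k, l)) :
  ~~ all_zero P -> exists M : 'M[bool]_(m, n), saturated M P.
Proof.
move=> P0.
have avoid0 : ~~ contains (const_mx false : 'M[bool]_(m, n)) P.
  apply: contra P0 => /existsP[f /existsP[g /and3P[_ _ /forallP Pfg]]].
  apply/eqP/matrixP => i j; have := forallP (Pfg i) j.
  by rewrite !mxE; case: (P i j).
case: (@arg_maxnP _ (const_mx false) (fun M : 'M[bool]_(m, n) => ~~ contains M P)
  (@weight m n) avoid0) => M MP Mmax.
exists M; rewrite /saturated MP /=; apply/forallP => i; apply/forallP => j.
apply/implyP => Mij; apply: contraT => /Mmax /=; rewrite leqNgt => /negP[].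
apply: proper_card; apply/properP; split.
  by apply/subsetP => -[x y]; rewrite !inE /= mxE => ->; rewrite orbT.
by exists (i, j); rewrite !inE /= ?mxE ?eqxx.
Qed.

Lemma sat_le n k l (P : 'M[bool]_(k, l)) (M : 'M[bool]_n) :
  saturated M P -> (sat n P <= weight M)%N.
Proof.
move=> MP; have := mem_index_enum M.
rewrite /sat; elim: (index_enum _) => // N s IHs; rewrite inE big_cons.
case/predU1P=> [<-|/IHs le_s]; first by rewrite MP geq_minl.
by case: ifP => // _; apply: leq_trans (geq_minr _ _) le_s.
Qed.

Lemma sat_attained n k l (P : 'M[bool]_(k, l)) :
  ~~ all_zero P -> exists2 M : 'M[bool]_n, saturated M P & weight M = sat n P.
Proof.
move=> /(saturated_exists n n)[M0 M0P].
case: (@arg_minnP _ M0 (fun M : 'M[bool]_n => saturated M P) (@weight n n) M0P) => M MP Mmin.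
exists M => //; apply/eqP; rewrite eqn_leq sat_le // andbT.
rewrite /sat; elim/big_ind: _ => [|a b ? ?|N /Mmin] //; first exact: weight_le.
by rewrite leq_min; apply/andP.
Qed.

(* Main.v *)
Require Import Defs.
From mathcomp Require Import all_boot all_order all_algebra.
From mathcomp Require Import zify.

Set Implicit Arguments.
Unset Strict Implicit.
Unset Printing Implicit Defensive.

(** A saturated matrix M for P of large size but bounded weight has an empty
    row r and an empty column q, and putting a one anywhere in that row or that
    column creates an occurrence of P. This single matrix, of fixed size, can be
    turned into P'-saturated matrices of bounded weight and every large size.

    Replace each line of M by a block of lines, keeping the ones of M at the
    centres of the blocks ([inflate]). The blocks are wide compared to P', and
    the blocks of r and q absorb whatever size is left. The result still avoids
    P, hence P': as P has no empty line, an occurrence of P only uses block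
    centres and collapses to an occurrence in M ([inflate_avoids]).

    A one added at (x, y) in the block of r or of q nevertheless creates P'
    ([inflate_expandable]). Let r', s' be the lines of M whose blocks contain
    x and y. Adding a one to M at (r', s') creates P, with the new one in the
    role of some entry of P. If r' is empty in M, that entry is alone in its
    row of P; if s' is empty, alone in its column. By hypothesis it is then
    alone in both, so the rest of the occurrence puts no constraint on the new
    one besides the order of the lines: it can move freely from the centre of
    its block to (x, y). All lines used are now either block centres or lie in
    different blocks from the centres used, so they are far apart, and the
    empty lines of P' fit in between ([spaced_extension]).

    Finally, add ones greedily until the matrix is P'-saturated. No one can
    appear in the blocks of r and q, so all ones lie in the intersection of the
    other blocks, whose size does not depend on n. *)

(** * Increasing maps and containment *)

Lemma increasingP m n (f : 'I_m -> 'I_n) :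
  reflect (forall i j : 'I_m, i < j -> f i < f j) (increasing f).
Proof.
apply: (iffP forallP) => [incf i j ltij|incf i].
  by have /forallP/(_ j)/implyP/(_ ltij) := incf i.
by apply/forallP => j; apply/implyP; apply: incf.
Qed.

Lemma increasing_inj m n (f : 'I_m -> 'I_n) : increasing f -> injective f.
Proof.
move=> /increasingP incf i j eqf; apply/val_inj/eqP.
by case: ltngtP => // /incf; rewrite eqf ltnn.
Qed.

Lemma increasing_le m n (f : 'I_m -> 'I_n) (i j : 'I_m) :
  increasing f -> (f i <= f j) = (i <= j).
Proof.
move=> /increasingP incf; case: (ltngtP i j) => [/incf/ltnW->//| |/val_inj->//].
  by move=> /incf; rewrite ltnNge => /negbTE.
by rewrite leqnn.
Qed.

Lemma containsP m n k l (M : 'M[bool]_(m, n)) (P : 'M[bool]_(k, l)) :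
  reflect (exists f g, [/\ increasing f, increasing g &
                           forall i j, P i j -> M (f i) (g j)])
          (contains M P).
Proof.
apply: (iffP existsP) => [[f /existsP[g /and3P[incf incg Pfg]]]|[f [g [incf incg Pfg]]]].
  exists f, g; split=> // i j Pij.
  by have /forallP/(_ j)/implyP/(_ Pij) := forallP Pfg i; rewrite mxE.
exists (finfun f); apply/existsP; exists (finfun g); apply/and3P; split.
- by apply/increasingP => i j; rewrite !ffunE; apply/increasingP.
- by apply/increasingP => i j; rewrite !ffunE; apply/increasingP.
apply/forallP => i; apply/forallP => j; apply/implyP => /Pfg.
by rewrite mxE !ffunE.
Qed.

Lemma contains_sub m n k l (M M' : 'M[bool]_(m, n)) (P : 'M[bool]_(k, l)) :
  (forall x y, M x y -> M' x y) -> contains M P -> contains M' P.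
Proof.
move=> sub /containsP[f [g [incf incg Pfg]]].
by apply/containsP; exists f, g; split=> // i j /Pfg/sub.
Qed.

Lemma contains_mxsub m n k l k' l' (M : 'M[bool]_(m, n))
    (P' : 'M[bool]_(k', l')) (f : 'I_k -> 'I_k') (g : 'I_l -> 'I_l') :
  increasing f -> increasing g -> contains M P' -> contains M (mxsub f g P').
Proof.
move=> /increasingP incf /increasingP incg.
move=> /containsP[F [G [/increasingP incF /increasingP incG PFG]]].
apply/containsP; exists (F \o f), (G \o g); split.
- by apply/increasingP => i j /incf/incF.
- by apply/increasingP => i j /incg/incG.
by move=> i j; rewrite mxE; apply: PFG.
Qed.

(** Take a heaviest matrix among those that dominate M and avoid P. *)
Lemma extend_to_saturated m n k l (M : 'M[bool]_(m, n)) (P : 'M[bool]_(k, l)) :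
  ~~ contains M P ->
  exists2 S : 'M[bool]_(m, n), saturated S P & forall x y, M x y -> S x y.
Proof.
move=> MP; pose good (S : 'M[bool]_(m, n)) :=
  ~~ contains S P && [forall x, forall y, M x y ==> S x y].
have goodM : good M.
  by rewrite /good MP; apply/forallP => x; apply/forallP => y; apply/implyP.
case: (@arg_maxnP _ M good (@weight m n) goodM) => S /andP[SP /forallP sub] Smax.
have {}sub x y : M x y -> S x y by have /forallP/(_ y)/implyP := sub x.
exists S => //; rewrite /saturated SP; apply/forallP => i; apply/forallP => j.
apply/implyP => Sij; apply: contraT => noP; suff: weight (set_one S i j) <= weight S.
  rewrite leqNgt => /negP[]; apply: proper_card; apply/properP; split.
    by apply/subsetP => -[x y]; rewrite !inE /= mxE => ->; rewrite orbT.
  by exists (i, j); rewrite !inE /= ?mxE ?eqxx.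
apply: Smax; rewrite /good noP; apply/forallP => x; apply/forallP => y.
by apply/implyP => /sub Sxy; rewrite mxE Sxy orbT.
Qed.

(** An occurrence whose lines are at distance more than k' from each other
    leaves room for the k' + 1 lines of a pattern with added empty lines. Since
    f fixes both ends, no room is required before the first line or after the
    last one. *)
Lemma spaced_extension k k' n D (f : 'I_k.+1 -> 'I_k'.+1) (X : 'I_k.+1 -> 'I_n) :
    increasing f -> f ord0 = ord0 -> f ord_max = ord_max -> k' < D ->
    (forall i j : 'I_k.+1, i < j -> X i + D <= X j) ->
  exists2 F : 'I_k'.+1 -> 'I_n, increasing F & forall i, F (f i) = X i.
Proof.
move=> incf f0 fmax ltD gapX.
(* Line t of the larger pattern is placed after the closest original line
   weakly before it, at the same distance from it as in the pattern. *)
pose idx (t : 'I_k'.+1) := [arg max_(i > (ord0 : 'I_k.+1) | f i <= t) (i : nat)].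
have idxP t : f (idx t) <= t /\ forall i, f i <= t -> i <= idx t.
  by rewrite /idx; case: arg_maxnP => [|i]; rewrite ?f0.
have idxf i : idx (f i) = i.
  have [le1 le2] := idxP (f i); apply/val_inj/eqP; rewrite eqn_leq le2 // andbT.
  by rewrite -(increasing_le _ _ incf).
have bnd t : X (idx t) + (t - f (idx t)) < n.
  have [_ maxi] := idxP t; have lti := ltn_ord (idx t).
  have [eqi|nei] := eqVneq (idx t) ord_max.
    by rewrite eqi fmax; have := ltn_ord t; have := ltn_ord (X ord_max) => /=; lia.
  have lt_max : idx t < @ord_max k.
    by have := nei; rewrite -val_eqE /=; have := lti; lia.
  have := gapX _ _ lt_max; have := ltn_ord (X ord_max).
  by have := ltn_ord t; lia.
exists (fun t => Ordinal (bnd t)); last first.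
  by move=> i; apply/val_inj; rewrite /= idxf subnn addn0.
apply/increasingP => t u lttu /=.
have [le_t _] := idxP t; have [le_u max_u] := idxP u.
have le_idx : idx t <= idx u by apply/max_u/(leq_trans le_t)/ltnW.
have [eqi|nei] := eqVneq (idx t) (idx u).
  by rewrite eqi in le_t *; lia.
have /gapX : idx t < idx u by rewrite ltn_neqAle le_idx andbT.
by have := ltn_ord t; lia.
Qed.

(** * Lines with at most one entry *)

Lemma weight_row_eq1 m n (M : 'M[bool]_(m, n)) i j0 :
  M i j0 -> weight (row i M) = 1 <-> (forall j, M i j -> j = j0).
Proof.
move=> Mij0; split=> [/eqP/cards1P[[z j1] eq1] j Mij|uniq].
  have mem j' : M i j' -> j' = j1.
    move=> Mij'; have : (z, j') \in [set (z, j1)] by rewrite -eq1 !inE /= mxE.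
    by rewrite inE => /eqP[].
  by rewrite (mem _ Mij) (mem _ Mij0).
apply/eqP/cards1P; exists (ord0, j0); apply/setP => -[z j].
rewrite !inE /= mxE (ord1 z) -[(_, _) == _]/(_ && _) eqxx /=.
by apply/idP/eqP => [/uniq|->].
Qed.

Lemma weight_tr m n (M : 'M[bool]_(m, n)) : weight M^T%R = weight M.
Proof.
have inj : injective (fun p : 'I_m * 'I_n => (p.2, p.1)) by move=> [? ?] [? ?] [-> ->].
rewrite /weight -(card_imset _ inj); apply: eq_card => -[y x].
rewrite inE /= mxE; apply/idP/imsetP => [Mxy|[[x' y'] Mp [-> ->]]].
  by exists (x, y); rewrite ?inE.
by rewrite inE in Mp.
Qed.

Lemma weight_col_eq1 m n (M : 'M[bool]_(m, n)) i0 j :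
  M i0 j -> weight (col j M) = 1 <-> (forall i, M i j -> i = i0).
Proof.
move=> Mi0j; rewrite -weight_tr tr_col.
have MTj : M^T%R j i0 by rewrite mxE.
have [to from] := weight_row_eq1 MTj.
split=> [/to uniq i Mij|uniq]; first by apply: uniq; rewrite mxE.
by apply: from => i; rewrite mxE; apply: uniq.
Qed.

(** If every row has a one, choosing one in each gives m distinct ones. *)
Lemma has_empty_row m n (M : 'M[bool]_(m, n)) :
  weight M < m -> exists i, empty_row M i.
Proof.
move=> ltw; apply/existsP; apply: contraLR ltw => /existsPn noempty.
have one i : exists j, M i j.
  by have := noempty i; rewrite /empty_row negb_forall => /existsP[j /negPn]; exists j.
rewrite -leqNgt -[leqLHS]card_ord.
have inj : injective (fun i => (i, xchoose (one i))) by move=> i j [].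
rewrite -(card_imset _ inj); apply/subset_leq_card/subsetP => p /imsetP[i _ ->].
by rewrite inE /=; apply: (xchooseP (one i)).
Qed.

Lemma has_empty_col m n (M : 'M[bool]_(m, n)) :
  weight M < n -> exists j, empty_col M j.
Proof.
rewrite -weight_tr => /has_empty_row[j /forallP emp]; exists j.
by apply/forallP => i; have := emp i; rewrite mxE.
Qed.

(** * Inflating a matrix *)

(** [phi] sends a line to the block containing it and [c] a block to its centre
    line. Blocks are ordered, and every line outside a block is at distance at
    least D from its centre. *)
Definition separated n N D (phi : 'I_n -> 'I_N) (c : 'I_N -> 'I_n) : Prop :=
  (forall (x : 'I_n) (t : 'I_N), phi x < t -> x + D <= c t) /\
  (forall (x : 'I_n) (t : 'I_N), t < phi x -> c t + D <= x).

Lemma separatedK n N D (phi : 'I_n -> 'I_N) c :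
  0 < D -> separated D phi c -> cancel c phi.
Proof.
move=> D0 [sepl sepr] t; apply/val_inj/eqP.
by case: ltngtP => // [/sepl|/sepr]; lia.
Qed.

Lemma separated_centre_lt n N D (phi : 'I_n -> 'I_N) c :
  0 < D -> separated D phi c -> forall t u : 'I_N, (c t < c u) = (t < u).
Proof.
move=> D0 sep t u; have cK := separatedK D0 sep; have [sepl sepr] := sep.
case: (ltngtP t u) => [ltu|ltu|/val_inj->]; last by rewrite ltnn.
  by have := sepl (c t) u; rewrite cK => /(_ ltu); lia.
by have := sepr (c t) u; rewrite cK => /(_ ltu); lia.
Qed.

(** Replacing the centre of the block of x by x itself keeps the lines of an
    occurrence apart, because all other lines are centres of other blocks. *)
Lemma moved_spaced n N D q (phi : 'I_n -> 'I_N) c (F : 'I_q -> 'I_N) x i0 :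
    0 < D -> separated D phi c -> increasing F -> F i0 = phi x ->
  forall i j : 'I_q, i < j ->
    (if i == i0 then x else c (F i)) + D <= (if j == i0 then x else c (F j)).
Proof.
move=> D0 sep /increasingP incF Fi0 i j ltij; have ltF := incF i j ltij.
have cK := separatedK D0 sep; have [sepl sepr] := sep.
have [eqi|nei] := eqVneq i i0; have [eqj|nej] := eqVneq j i0.
- by rewrite eqi eqj ltnn in ltij.
- by apply: sepl; rewrite -Fi0 -eqi.
- by apply: sepr; rewrite -Fi0 -eqj.
- by apply: sepl; rewrite cK.
Qed.

(** All blocks have width 2D, except that block r takes the excess width: this
    is what allows matrices of every size n, with a number of lines outside
    block r that does not depend on n. *)
Lemma block_layout N D n (r : 'I_N) : 0 < D -> N * D.*2 <= n ->
  exists (phi : 'I_n -> 'I_N) (c : 'I_N -> 'I_n),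
    separated D phi c /\ #|[set x | phi x != r]| <= (N * D.*2).*2.
Proof.
move=> D0; have [W WD] : exists W, W = D.*2 by exists D.*2.
rewrite -WD => leWn; have W0 : 0 < W by rewrite WD double_gt0.
have [e en] : exists e, n = N * W + e by exists (n - N * W); rewrite subnKC.
(* Left of block r the block of x is x %/ W, and right of it (x - e) %/ W; the
   minimum with the clamped second value selects the correct case. *)
pose phi x := minn (x %/ W) (maxn r ((x - e) %/ W)).
pose c t := t * W + D + (if r < t then e else 0).
have phi_lt (x : 'I_n) : phi x < N.
  rewrite /phi gtn_min gtn_max ltn_ord /= [X in _ || X]ltn_divLR //.
  apply/orP; right.
  have : 0 < N * W by rewrite muln_gt0 W0 (leq_ltn_trans _ (ltn_ord r)).
  by have := ltn_ord x; lia.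
have c_lt (t : 'I_N) : c t < n.
  have : t.+1 * W <= N * W by rewrite leq_mul2r ltn_ord orbT.
  by rewrite /c mulSn; case: ifP; lia.
exists (fun x => Ordinal (phi_lt x)), (fun t => Ordinal (c_lt t)); split; first split.
- move=> x t; rewrite /= /phi /c gtn_min gtn_max !ltn_divLR //.
  by case: ifP; lia.
- move=> x t; rewrite /= /phi /c leq_min leq_max !leq_divRL // !mulSn.
  by case: ifP; lia.
(* A line left of block r is among the first N * W lines, and a line right of
   it is among the last N * W ones. *)
have sub : [set x : 'I_n | Ordinal (phi_lt x) != r]
    \subset [set x : 'I_n | x < N * W] :|: [set x : 'I_n | e <= x].
  apply/subsetP => x; rewrite !inE -val_eqE /= /phi; apply: contraR.
  rewrite negb_or -leqNgt -ltnNge => /andP[le1 lt2].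
  have -> : x - e = 0 by apply/eqP; rewrite subn_eq0 ltnW.
  rewrite div0n maxn0; apply/eqP/minn_idPr; rewrite leq_divRL //.
  by rewrite (leq_trans _ le1) // leq_mul2r (ltnW (ltn_ord r)) orbT.
have card_lt : #|[set x : 'I_n | x < N * W]| <= N * W.
  pose h (x : 'I_(N * W)) := widen_ord leWn x.
  have h_inj : injective h by move=> x y /(congr1 val)/= /val_inj.
  rewrite -[leqRHS]card_ord -(card_imset _ h_inj).
  apply/subset_leq_card/subsetP => x; rewrite inE => lx.
  by apply/imsetP; exists (Ordinal lx) => //; apply/val_inj.
have card_ge : #|[set x : 'I_n | e <= x]| <= N * W.
  rewrite -(card_imset _ rev_ord_inj); apply: leq_trans card_lt.
  apply/subset_leq_card/subsetP => y /imsetP[x]; rewrite !inE => lex -> /=.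
  by have := ltn_ord x; lia.
rewrite (leq_trans (subset_leq_card sub)) // (leq_trans (leq_card_setU _ _)) //.
by rewrite -addnn leq_add.
Qed.

Definition inflate m n N K (phi : 'I_m -> 'I_N) (c : 'I_N -> 'I_m)
    (psi : 'I_n -> 'I_K) (d : 'I_K -> 'I_n) (M : 'M[bool]_(N, K)) : 'M[bool]_(m, n) :=
  \matrix_(x, y) [&& c (phi x) == x, d (psi y) == y & M (phi x) (psi y)].

(** In a pattern without empty lines every line of an occurrence contains a one
    of the inflated matrix, hence is the centre of a block. *)
Lemma inflate_avoids k l m n N K D (phi : 'I_m -> 'I_N) c (psi : 'I_n -> 'I_K) d
    (M : 'M[bool]_(N, K)) (P : 'M[bool]_(k, l)) :
    0 < D -> separated D phi c -> separated D psi d ->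
    (forall i, ~~ empty_row P i) -> (forall j, ~~ empty_col P j) ->
  ~~ contains M P -> ~~ contains (inflate phi c psi d M) P.
Proof.
move=> D_gt0 sepR sepC Prows Pcols; apply: contra => /containsP[f [g [/increasingP incf /increasingP incg Pfg]]].
have cf i : c (phi (f i)) = f i.
  have := Prows i; rewrite negb_forall => /existsP[j /negPn/Pfg].
  by rewrite mxE => /and3P[/eqP].
have dg j : d (psi (g j)) = g j.
  have := Pcols j; rewrite negb_forall => /existsP[i /negPn/Pfg].
  by rewrite mxE => /and3P[_ /eqP].
apply/containsP; exists (phi \o f), (psi \o g); split.
- by apply/increasingP => i j /incf; rewrite -cf -(cf j) (separated_centre_lt D_gt0 sepR).
- by apply/increasingP => i j /incg; rewrite -dg -(dg j) (separated_centre_lt D_gt0 sepC).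
by move=> i j /Pfg; rewrite mxE => /and3P[].
Qed.

(** * Occurrences created by one new entry *)

Lemma new_one_is_used m n k l (M : 'M[bool]_(m, n)) (P : 'M[bool]_(k, l)) r s
    (F : 'I_k -> 'I_m) (G : 'I_l -> 'I_n) :
    increasing F -> increasing G ->
    (forall i j, P i j -> set_one M r s (F i) (G j)) -> ~~ contains M P ->
  exists i0 j0, [/\ P i0 j0, F i0 = r & G j0 = s].
Proof.
move=> incF incG PFG noP.
case: (boolP [exists i0, [exists j0, [&& P i0 j0, F i0 == r & G j0 == s]]]).
  by case/existsP=> i0 /existsP[j0 /and3P[? /eqP ? /eqP ?]]; exists i0, j0.
move/existsPn => none; case/containsP: noP; exists F, G; split=> // i j Pij.
have := PFG i j Pij; rewrite mxE => /orP[/andP[Fr Gs]|//].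
by have /existsPn/(_ j) := none i; rewrite Pij Fr Gs.
Qed.

(** The new one plays an entry of P which is alone in its row and its column,
    so it may sit anywhere in its block instead of at the centre. *)
Lemma inflate_expandable (k l k' l' m n N K D : nat)
    (P : 'M[bool]_(k.+1, l.+1)) (P' : 'M[bool]_(k'.+1, l'.+1))
    (M : 'M[bool]_(N, K)) (phi : 'I_m -> 'I_N) c (psi : 'I_n -> 'I_K) d x y :
    k' < D -> l' < D -> separated D phi c -> separated D psi d ->
    (forall i j, P i j -> (weight (row i P) = 1 <-> weight (col j P) = 1)) ->
    adds_interior_empty_lines P P' -> saturated M P ->
    empty_row M (phi x) || empty_col M (psi y) ->
  contains (set_one (inflate phi c psi d M) x y) P'.
Proof.
move=> ltk ltl sepR sepC single [f [g [[incf f0 fm] [incg g0 gm] defP rowP' colP']]].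
case/andP=> noP /forallP satM emptyxy.
have D0 : 0 < D by apply: leq_trans ltk.
have cK := separatedK D0 sepR; have dK := separatedK D0 sepC.
have Mxy : ~~ M (phi x) (psi y).
  by case/orP: emptyxy => /forallP; apply.
have /forallP/(_ (psi y))/implyP/(_ Mxy) := satM (phi x).
case/containsP=> F [G [incF incG PFG]].
have [i0 [j0 [P0 F0 G0]]] := new_one_is_used incF incG PFG noP.
have Finj := increasing_inj incF; have Ginj := increasing_inj incG.
(* The line of M that is empty only contains the new one afterwards, which
   makes (i0, j0) alone in one direction; the hypothesis on P gives the other. *)
have [rowu colu] : (forall j, P i0 j -> j = j0) /\ (forall i, P i j0 -> i = i0).
  case/orP: emptyxy => /forallP emp.
    have rowu j : P i0 j -> j = j0.
      move=> /PFG; rewrite mxE F0 (negbTE (emp _)) orbF => /andP[_ /eqP Gj].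
      by apply: Ginj; rewrite G0.
    by split=> //; apply/(weight_col_eq1 P0)/(single _ _ P0)/(weight_row_eq1 P0).
  have colu i : P i j0 -> i = i0.
    move=> /PFG; rewrite mxE G0 (negbTE (emp _)) orbF => /andP[/eqP Fi _].
    by apply: Finj; rewrite F0.
  by split=> //; apply/(weight_row_eq1 P0)/(single _ _ P0)/(weight_col_eq1 P0).
(* The lines through (i0, j0) go to x and y, all others to block centres. *)
have [X incX Xf] := spaced_extension
  (X := fun i => if i == i0 then x else c (F i)) incf f0 fm ltk
  (fun i j => moved_spaced D0 sepR incF F0 (i := i) (j := j)).
have [Y incY Yg] := spaced_extension
  (X := fun j => if j == j0 then y else d (G j)) incg g0 gm ltl
  (fun i j => moved_spaced D0 sepC incG G0 (i := i) (j := j)).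
apply/containsP; exists X, Y; split=> // t u P'tu.
have /codomP[i ti] : t \in codom f.
  by apply: contraLR P'tu => /rowP'/forallP; apply.
have /codomP[j uj] : u \in codom g.
  by apply: contraLR P'tu => /colP'/forallP; apply.
have Pij : P i j by rewrite defP mxE -ti -uj.
rewrite ti uj Xf Yg mxE.
(* An entry of P other than (i0, j0) avoids both row i0 and column j0, so it
   is realized by a one of M, which sits at block centres. *)
have [eqi|nei] := eqVneq i i0.
  by rewrite eqi in Pij *; rewrite (rowu _ Pij) !eqxx.
have [eqj|nej] := eqVneq j j0.
  by rewrite eqj in Pij; rewrite (colu _ Pij) eqxx in nei.
rewrite !mxE cK dK !eqxx /=; have := PFG i j Pij; rewrite mxE -F0.
by rewrite (inj_eq Finj) (negbTE nei) /= => ->; rewrite orbT.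
Qed.

Theorem corollary4p7 (k l k' l' : nat)
    (P : 'M[bool]_(k.+1, l.+1)) (P' : 'M[bool]_(k'.+1, l'.+1))
    (P_indec : indecomposable P)
    (P_rows : forall i, ~~ empty_row P i)
    (P_cols : forall j, ~~ empty_col P j)
    (P_last_row : weight (row ord_max P) = 1%N)
    (P_last_col : weight (col ord_max P) = 1%N)
    (P_sat : sat_bounded P)
    (P_single : forall i j, P i j ->
       (weight (row i P) = 1%N <-> weight (col j P) = 1%N))
    (P'_from_P : adds_interior_empty_lines P P') :
  sat_bounded P'.
Proof.
have [C [N satC]] := P_sat.
have P_nonzero : ~~ all_zero P.
  apply: contra (P_rows ord0) => /eqP->.
  by apply/forallP => j; rewrite mxE.
(* The size s exceeds C to force empty lines in M. *)
pose s := maxn N C.+1; have [M satM wM] := sat_attained s P_nonzero.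
have ltw : weight M < s.
  by rewrite wM (leq_ltn_trans (satC _ (leq_maxl _ _))) // leq_maxr.
have [r emp_r] := has_empty_row ltw; have [q emp_q] := has_empty_col ltw.
pose D := (maxn k' l').+1; pose B := (s * D.*2).*2.
exists (B * B), (s * D.*2) => n len.
have [phi [c [sepR cardR]]] := block_layout r (ltn0Sn _ : 0 < D) len.
have [psi [d [sepC cardC]]] := block_layout q (ltn0Sn _ : 0 < D) len.
set A := inflate phi c psi d M.
have AP' : ~~ contains A P'.
  have /andP[MP _] := satM.
  have := inflate_avoids (ltn0Sn _ : 0 < D) sepR sepC P_rows P_cols MP.
  apply: contra; case: P'_from_P => f [g [[incf _ _] [incg _ _] -> _ _]].
  exact: contains_mxsub.
(* The ones of any saturated S above A avoid the blocks r and q, where they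
   would create P'. *)
have [S satS subS] := extend_to_saturated AP'.
apply: leq_trans (sat_le satS) _; have /andP[SP' _] := satS.
apply: leq_trans (leq_mul cardR cardC); rewrite -cardsX.
apply/subset_leq_card/subsetP => -[x y]; rewrite !inE /= => Sxy.
rewrite -negb_or; apply: contra SP' => blocks.
have : contains (set_one A x y) P'.
  apply: inflate_expandable sepR sepC P_single P'_from_P satM _.
  - by rewrite ltnS leq_maxl.
  - by rewrite ltnS leq_maxr.
  by case/orP: blocks => /eqP->; rewrite ?emp_r ?emp_q ?orbT.
by apply: contains_sub => x' y'; rewrite mxE => /orP[/andP[/eqP-> /eqP->]|/subS].
Qed.
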